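(* Let $1\le p<\infty$, and assume that the sequences $\beta,\delta$ satisfy the standing assumption (stated in the context) for this $p$. Then the maximal ideal space of $(\ell^p(\beta),\diamond)$ (the set of its nonzero multiplicative linear functionals) consists of exactly one homomorphism, namely $\varphi(f)=\hat f(0)$, $f\in\ell^p(\beta)$.
   Context: Let $\{\beta(n)\}_{n\ge 0}$ and $\{\delta_n\}_{n\ge 0}$ be sequences of positive numbers with $\beta(0)=1$ and $\delta_0=1$; $\mathbb{N}=\{1,2,\dots\}$. For $1\le p<\infty$, $\ell^p(\beta)$ is the Banach space of complex sequences $f=\{\hat f(n)\}_{n\ge 0}$, written as formal power series $f(z)=\sum_{n\ge 0}\hat f(n)z^n$ (no convergence required), with $\|f\|_\beta^p=\sum_{n\ge 0}|\hat f(n)|^p\beta(n)^p<\infty$. The weighted Cauchy product is $f\diamond g=\sum_{n\ge 0}\sum_{m\ge 0}\frac{\delta_{n+m}}{\delta_n\delta_m}\hat f(n)\hat g(m)z^{n+m}$, i.e. $\widehat{(f\diamond g)}(n)=\sum_{k=0}^n\frac{\delta_n}{\delta_k\delta_{n-k}}\hat f(k)\hat g(n-k)$; the constant series $1$ is its unit. Under the standing assumption the paper regards $(\ell^p(\beta),\diamond)$ as a unital commutative Banach algebra (with norm submultiplicative up to a constant). Standing assumption. If $1<p<\infty$, with conjugate exponent $q$: $\sup_{n\ge 0}\sum_{k=0}^{n}\left(\frac{\delta_n\beta(n)}{\delta_k\delta_{n-k}\beta(k)\beta(n-k)}\right)^{q}<\infty$, and for every integer $k\ge 1$, $b_{M,k}:=\sup_{n\ge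 M+1}\frac{\delta_{n+k}\beta(n+k)}{\delta_n\delta_k\beta(n)\beta(k)}$ satisfies $\lim_{M\to\infty}b_{M,k}=0$. If $p=1$: for some $N\in\mathbb{N}$, $\sum_{n,m\ge N+1}\frac{\delta_{n+m}\beta(n+m)}{\delta_n\delta_m\beta(n)\beta(m)}<\infty$. *)

(* Defs.v *)
From HB Require Import structures.
From mathcomp Require Import all_boot all_order all_algebra.
From mathcomp Require Import all_classical all_reals all_analysis.
From mathcomp Require Import complex.

Set Implicit Arguments.
Unset Strict Implicit.
Unset Printing Implicit Defensive.

Import Order.TTheory GRing.Theory Num.Theory ComplexField.Normc.
Import numFieldNormedType.Exports.

Local Open Scope classical_set_scope.
Local Open Scope ring_scope.

(* A formal power series is identified with its coefficient sequence; the
   codomain is [R[i]^o], i.e. [R[i]] seen as a vector space over itself. *)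
Notation fpseries R := (nat -> R[i]^o).

(* ||f||_beta ^ p *)
Definition lpb_npow (R : realType) (beta : nat -> R) (p : R) (f : fpseries R)
  : \bar R :=
  (\sum_(0 <= n <oo) (normc (f n) `^ p * beta n `^ p)%:E)%E.

(* [hp] does not occur in the body: carrying it lets the vector space structure
   be inferred. *)
Definition lpb_pred (R : realType) (beta : nat -> R) (p : R) (hp : 1 <= p)
  : {pred fpseries R} := fun f => `[< (lpb_npow beta p f < +oo)%E >].

Section lpb_submod.
Context (R : realType) (beta : nat -> R) (p : R) (hp : 1 <= p).

Let term_ge0 (f : fpseries R) (n : nat) :
  (0 <= (normc (f n) `^ p * beta n `^ p)%:E)%E.
Proof. by rewrite lee_fin mulr_ge0 ?powR_ge0. Qed.

Let p_gt0 : 0 < p. Proof. exact: lt_le_trans hp. Qed.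

Let normc_ge0 (x : R[i]) : 0 <= normc x.
Proof. by case: x => a b; exact: sqrtr_ge0. Qed.

Lemma lpb_submod_closed : submod_closed (lpb_pred beta hp).
Proof.
split.
  apply/asboolP; rewrite /lpb_npow eseries0 ?ltry// => n _ _.
  by rewrite normc0 powR0 ?mul0r// gt_eqF.
move=> a f g /asboolP hf /asboolP hg; apply/asboolP.
pose c : R := (2 * Num.max 1 (normc a)) `^ p.
have c0 : 0 <= c by exact: powR_ge0.
have : (lpb_npow beta p (a *: f + g)%R <=
        c%:E * (lpb_npow beta p f + lpb_npow beta p g))%E.
  rewrite /lpb_npow -nneseriesD//; [|by move=> *; exact: term_ge0..].
  rewrite -nneseriesZl; last by move=> n _; rewrite adde_ge0.
  apply: lee_nneseries => [n _ _|n _]; first exact: term_ge0.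
  rewrite -EFinD -EFinM lee_fin -mulrDl mulrA ler_wpM2r ?powR_ge0//.
  set x := normc (f n); set y := normc (g n).
  set m := Num.max x y; set A := Num.max 1 (normc a).
  have A1 : 1 <= A by rewrite le_max lexx.
  have A0 : 0 <= A by exact: le_trans A1.
  have m0 : 0 <= m by rewrite le_max normc_ge0.
  apply: (@le_trans _ _ ((2 * A * m) `^ p)).
    rewrite ge0_ler_powR ?nnegrE ?mulr_ge0 ?normc_ge0 ?(ltW p_gt0)//.
    apply: (le_trans (le_normcD _ _)).
    have -> : 2 * A * m = A * m + A * m by rewrite -mulrA mulr_natl mulr2n.
    apply: lerD.
      have -> : normc ((a *: f) n) = normc a * x.
        by rewrite -normcM.
      by apply: ler_pM; rewrite ?normc_ge0// le_max lexx ?orbT.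
    by rewrite -[leLHS]mul1r ler_pM ?normc_ge0// le_max lexx orbT.
  rewrite powRM ?mulr_ge0// ler_wpM2l//.
  by rewrite /m; case: (leP x y) => _; rewrite ?lerDr ?lerDl powR_ge0.
move=> /le_lt_trans; apply.
rewrite lte_mul_pinfty ?lee_fin// lte_add_pinfty//.
Qed.

HB.instance Definition _ :=
  GRing.isSubmodClosed.Build _ _ (lpb_pred beta hp) lpb_submod_closed.

End lpb_submod.

Record lpb (R : realType) (beta : nat -> R) (p : R) (hp : 1 <= p) := Lpb {
  lpb_coef :> fpseries R;
  lpb_coefP : lpb_coef \in lpb_pred beta hp }.

HB.instance Definition _ (R : realType) (beta : nat -> R) (p : R) (hp : 1 <= p) :=
  [isSub for @lpb_coef R beta p hp].
HB.instance Definition _ (R : realType) (beta : nat -> R) (p : R) (hp : 1 <= p) :=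
  [Choice of lpb beta hp by <:].
HB.instance Definition _ (R : realType) (beta : nat -> R) (p : R) (hp : 1 <= p) :=
  [SubChoice_isSubLmodule of lpb beta hp by <:].

(* The coefficients of the weighted Cauchy product of f and g. *)
Definition wcauchy (R : realType) (delta : nat -> R) (f g : fpseries R)
  : fpseries R :=
  fun n => \sum_(k < n.+1)
    (delta n / (delta k * delta (n - k)%N))%:C%C * f k * g (n - k)%N.

Definition wratio (R : realType) (beta delta : nat -> R) (n m : nat) : R :=
  (delta (n + m)%N * beta (n + m)%N) /
  (delta n * delta m * beta n * beta m).

(* b_{M,k}; the supremum is taken in the extended reals because the real [sup]
   of an unbounded set is 0. *)
Definition bsup (R : realType) (beta delta : nat -> R) (M k : nat) : \bar R :=
  ereal_sup [set (wratio beta delta n k)%:E | n in [set n | (M.+1 <= n)%N]].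

Definition standing_assumption (R : realType) (beta delta : nat -> R) (p : R)
  : Prop :=
  (1 < p ->
     (let q := fine (hoelder_conjugate p%:E) in
      (ereal_sup [set (\sum_(k < n.+1)
         (delta n * beta n /
          (delta k * delta (n - k)%N * beta k * beta (n - k)%N)) `^ q)%:E
         | n in [set: nat]] < +oo)%E) /\
     (forall k, (1 <= k)%N -> bsup beta delta M k @[M --> \oo] --> 0%E)) /\
  (p = 1 -> exists2 N, (1 <= N)%N &
     (\esum_(nm in [set nm : nat * nat | (N.+1 <= nm.1)%N /\ (N.+1 <= nm.2)%N])
        (wratio beta delta nm.1 nm.2)%:E < +oo)%E).

(* The nonzero multiplicative linear functionals on l^p(beta).  The product is
   only partial on an arbitrary l^p(beta), so multiplicativity reads
   phi h = phi f * phi g whenever h in l^p(beta) is the product of f and g; when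
   l^p(beta) is closed under the product, so that it is an algebra, this is the
   usual condition on all pairs f, g. *)
Definition maximal_ideal_space (R : realType) (beta delta : nat -> R) (p : R)
    (hp : 1 <= p) : set (lpb beta hp -> R[i]) :=
  [set phi | [/\ scalar phi,
     exists f, phi f <> 0 &
     forall f g h : lpb beta hp,
       lpb_coef h = wcauchy delta f g -> phi h = phi f * phi g]].
Arguments maximal_ideal_space {R} beta delta {p} hp.

(* Main.v *)
Require Import Defs.
From mathcomp Require Import all_boot all_order all_algebra.
From mathcomp Require Import all_classical all_reals all_analysis.
From mathcomp Require Import complex.
From mathcomp Require Import ring lra zify.

(** A multiplicative functional phi takes the value 1 at the constant series 1
    and cannot vanish at an invertible series.  So if every g = 1 + f, with f
    ranging over a linear space of series, has its formal inverse in l^p(beta),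
    then phi vanishes on that space: from phi f = l <> 0 one gets
    phi (1 - f / l) = 0.  The heart of the matter is therefore to bound the
    formal inverse h of g.

    Write w(k, m) = delta_(k+m) beta_(k+m) / (delta_k delta_m beta_k beta_m),
    F k = |g_k| beta_k and H n = |h_n| beta_n.  The recursion that defines h
    gives, for n > 0,
      H n <= \sum_(0 < k <= n) w(k, n - k) F k H(n - k).
    Two properties of w are used ([standing_gap]): convolution with weight w is
    bounded on l^p ([conv_bounded], which is Hoelder's inequality for p > 1),
    and w(k, m) tends to 0 as m goes to infinity for each k
    ([vanishing_rows]).  Cut the sum at a large k = K.  The terms k >= K
    contribute little because the tail of F is small in l^p, the terms k < K
    contribute little because w(k, n - k) is small once n is large.  Hence the
    sequence v n = H n ^ p satisfies a renewal inequality
      v n <= \sum_(k <= n) a_k v(n - k)   for n large,  with \sum a_k <= 1/2,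
    and summing over n shows that \sum v n is finite ([renewal_bounded],
    [bounded_sums_lp]).

    For p > 1 this applies to every f without constant term.  For p = 1 the
    assumption says nothing about w(k, m) when k <= N or 0 < m <= N, so the
    argument is restricted to f vanishing in degrees <= N.  This suffices: the
    square of z^j is a multiple of z^(2j), so phi (z^j) ^ 2 = 0 as soon as phi
    vanishes on the series that start in degree j + 1, and descending induction
    on j shows that phi vanishes on all series without constant term. *)

Import Order.TTheory GRing.Theory Num.Theory ComplexField.Normc.
Import numFieldNormedType.Exports.

Set Implicit Arguments.
Unset Strict Implicit.
Unset Printing Implicit Defensive.

Local Open Scope classical_set_scope.
Local Open Scope ring_scope.

(** * Inequalities for sums of p-th powers *)

Section SumInequalities.
Variable R : realType.
Implicit Types (p q : R) (n : nat).

Definition bounded_sums (u : nat -> R) := exists S, forall n, \sum_(k < n) u k <= S.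

Lemma powRD_le p (x y : R) : 0 <= p -> 0 <= x -> 0 <= y ->
  (x + y) `^ p <= 2 `^ p * (x `^ p + y `^ p).
Proof.
move=> p0 x0 y0; wlog xy : x y x0 y0 / x <= y.
  move=> wl; have [/wl|/ltW/wl] := leP x y; first exact.
  by rewrite [y + x]addrC [y `^ p + _]addrC; exact.
apply: (@le_trans _ _ ((2 * y) `^ p)).
  by rewrite ge0_ler_powR ?nnegrE ?addr_ge0 ?mulr_ge0//; lra.
by rewrite powRM// ler_wpM2l ?powR_ge0// lerDr powR_ge0.
Qed.

(** The crude constant is harmless: it is only used for a number of terms fixed
    beforehand, and is absorbed by a small factor chosen afterwards. *)
Lemma powR_sum_le p (y : nat -> R) n : 0 < p -> (forall k, 0 <= y k) ->
  (\sum_(k < n) y k) `^ p <= (2 `^ p) ^+ n * \sum_(k < n) y k `^ p.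
Proof.
move=> p0 y0; elim: n => [|n IH].
  by rewrite !big_ord0 mulr0 powR0 ?gt_eqF.
have two1 : 1 <= (2 `^ p) ^+ n :> R.
  rewrite exprn_ege1// -[leLHS](powRr0 2); apply: ler_powR; last exact: ltW.
  by rewrite ler1n.
have s0 : 0 <= \sum_(k < n) y k by apply: sumr_ge0.
rewrite !big_ord_recr/= (le_trans (powRD_le (ltW p0) s0 (y0 n)))//.
rewrite exprS -mulrA ler_wpM2l ?powR_ge0// mulrDr lerD//.
by rewrite ler_peMl ?powR_ge0.
Qed.

(** Both factors are normalised to norm 1; Young's inequality then bounds the sum
    of the products by 1/p + 1/q = 1. *)
Lemma hoelder_sum p q (w y : nat -> R) n : 0 < p -> 0 < q -> p^-1 + q^-1 = 1 ->
  (forall k, 0 <= w k) -> (forall k, 0 <= y k) ->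
  \sum_(k < n) w k * y k <=
    (\sum_(k < n) w k `^ q) `^ q^-1 * (\sum_(k < n) y k `^ p) `^ p^-1.
Proof.
move=> p0 q0 pq w0 y0.
set A := _ `^ q^-1; set Y := _ `^ p^-1.
have s0 (u : nat -> R) r : \sum_(k < n) u k `^ r >= 0.
  by apply: sumr_ge0 => k _; exact: powR_ge0.
have van (u : nat -> R) r : 0 < r -> (forall k, 0 <= u k) ->
    (\sum_(k < n) u k `^ r) `^ r^-1 = 0 -> forall k : 'I_n, u k = 0.
  move=> r0 u0 /powR_eq0_eq0 /eqP; rewrite psumr_eq0; last first.
    by move=> k _; exact: powR_ge0.
  by move=> /allP h k; have := h k (mem_index_enum k) => /eqP /powR_eq0_eq0.
have [A0|A0] := eqVneq A 0.
  by rewrite A0 mul0r big1// => k _; rewrite (van _ _ q0 w0 A0) mul0r.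
have [Y0|Y0] := eqVneq Y 0.
  by rewrite Y0 mulr0 big1// => k _; rewrite (van _ _ p0 y0 Y0) mulr0.
have Ap : 0 < A by rewrite lt0r A0 powR_ge0.
have Yp : 0 < Y by rewrite lt0r Y0 powR_ge0.
have AE : A `^ q = \sum_(k < n) w k `^ q.
  by rewrite -powRrM mulVf ?gt_eqF// powRr1.
have YE : Y `^ p = \sum_(k < n) y k `^ p.
  by rewrite -powRrM mulVf ?gt_eqF// powRr1.
clearbody A Y; have AY : 0 <= A * Y by rewrite ltW// mulr_gt0.
apply: (@le_trans _ _ (\sum_(k < n)
   A * Y * ((y k / Y) `^ p / p + (w k / A) `^ q / q))).
  apply: ler_sum => k _.
  have -> : w k * y k = A * Y * (y k / Y * (w k / A)).
    by field; rewrite A0.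
  rewrite ler_wpM2l// conjugate_powR ?divr_ge0// ltW//.
rewrite -mulr_sumr big_split/= -!mulr_suml.
have norm1 (u : nat -> R) r (B : R) : 0 < B -> B `^ r = \sum_(k < n) u k `^ r ->
    (forall k, 0 <= u k) ->
    \sum_(k < n) (u k / B) `^ r = 1.
  move=> B0 BE u0; under eq_bigr => k _.
    rewrite powRM ?invr_ge0 ?(ltW B0)//. over.
  by rewrite -mulr_suml -BE -powRM ?invr_ge0 ?(ltW B0)// divff ?gt_eqF// powR1.
by rewrite !norm1// !mul1r pq mulr1.
Qed.

Lemma conv_sum (a v : nat -> R) n :
  \sum_(m < n) \sum_(k < m.+1) a k * v (m - k)%N =
  \sum_(k < n) a k * \sum_(m < n - k) v m.
Proof.
elim: n => [|n IH]; first by rewrite !big_ord0.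
rewrite big_ord_recr/= IH [RHS]big_ord_recr/= subSnn big_ord1.
rewrite [X in _ + X]big_ord_recr/= subnn addrA -big_split/=; congr (_ + _).
apply: eq_bigr => k _; rewrite -mulrDr subSn ?(ltnW (ltn_ord k))//.
by rewrite big_ord_recr.
Qed.

Lemma le_sum_nat (v : nat -> R) m n : (forall k, 0 <= v k) -> (m <= n)%N ->
  \sum_(k < m) v k <= \sum_(k < n) v k.
Proof.
move=> v0 mn; rewrite -(subnKC mn) big_split_ord/= lerDl.
by apply: sumr_ge0.
Qed.

(** * Renewal inequalities *)

(** Summing the inequality over n < L bounds the partial sum V L by V n0 plus
    (sum of a) * V L <= V L / 2, and the last term can be absorbed on the left. *)
Lemma renewal_bounded (a v : nat -> R) n0 :
  (forall k, 0 <= a k) -> (forall k, 0 <= v k) ->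
  (forall n, \sum_(k < n) a k <= 2^-1) ->
  (forall n, (n0 <= n)%N -> v n <= \sum_(k < n.+1) a k * v (n - k)%N) ->
  bounded_sums v.
Proof.
move=> a0 v0 ha hv; pose V n := \sum_(k < n) v k.
have V0 n : 0 <= V n by apply: sumr_ge0.
pose c m := \sum_(k < m.+1) a k * v (m - k)%N.
have c0 m : 0 <= c m by apply: sumr_ge0 => k _; exact: mulr_ge0.
have hV n : V n <= V n0 + \sum_(m < n) c m.
  elim: n => [|n IH]; first by rewrite /V !big_ord0 addr0 V0.
  have [nn0|nn0] := ltnP n n0.
    by apply: (le_trans (le_sum_nat v0 nn0)); rewrite lerDl sumr_ge0.
  by rewrite {1}/V !big_ord_recr/= addrA lerD// hv.
exists (2 * V n0) => n; have := hV n; rewrite conv_sum.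
have : \sum_(k < n) a k * \sum_(m < n - k) v m <= 2^-1 * V n.
  rewrite (@le_trans _ _ ((\sum_(k < n) a k) * V n))//; last by rewrite ler_wpM2r.
  rewrite mulr_suml ler_sum// => k _; rewrite ler_wpM2l// le_sum_nat ?leq_subr//.
by rewrite -/(V n) => h1 h2; lra.
Qed.

Lemma bounded_sums_tail (u : nat -> R) e : (forall k, 0 <= u k) ->
  bounded_sums u -> 0 < e ->
  exists K, forall n, \sum_(k < n) (if (K <= k)%N then u k else 0) <= e.
Proof.
move=> u0 [S hS] e0.
have hs : has_sup (range (fun n => \sum_(k < n) u k)).
  by split; [exists 0; exists 0%N; rewrite // big_ord0|exists S => _ [n _ <-]].
have [_ [K _ <-] hK] := sup_adherent e0 hs.
exists K => n.
have h : \sum_(k < n) (if (K <= k)%N then u k else 0)  + \sum_(k < K) u k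
   <= \sum_(k < maxn n K) u k.
  have -> : \sum_(k < K) u k = \sum_(k < maxn n K) (if (k < K)%N then u k else 0).
    rewrite -big_mkcond/= (big_ord_widen_cond _ predT u (leq_maxr n K)).
    by apply: eq_bigl.
  apply: le_trans (lerD (@le_sum_nat (fun k => if (K <= k)%N then u k else 0)
    n (maxn n K) _ (leq_maxl _ _)) (lexx _)) _; first by move=> k; case: ifP.
  rewrite -big_split/= ler_sum// => k _.
  by case: leqP; rewrite ?add0r ?addr0.
have : \sum_(k < maxn n K) u k <= sup (range (fun n => \sum_(k < n) u k)).
  by apply: ub_le_sup; [case: hs|exists (maxn n K)].
by move=> h2; lra.
Qed.

Lemma bounded_sums_cvg0 (u : nat -> R) e : (forall k, 0 <= u k) ->
  bounded_sums u -> 0 < e -> exists M, forall m, (M <= m)%N -> u m <= e.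
Proof.
move=> u0 hu e0; have [K hK] := bounded_sums_tail u0 hu e0.
exists K => m Km; apply: le_trans (hK m.+1).
rewrite big_ord_recr/= Km lerDr; apply: sumr_ge0 => k _.
by case: ifP.
Qed.

(** Convolution with weight W maps l^p x l^p to l^p: apply this to
    y k = F k * H (n - k) and sum over n. *)
Definition conv_bounded p (W : nat -> nat -> R) :=
  exists2 C, 0 <= C & forall n (y : nat -> R), (forall k, 0 <= y k) ->
    (\sum_(k < n.+1) W k (n - k)%N * y k) `^ p <=
      C * \sum_(k < n.+1) y k `^ p.

Definition vanishing_rows (W : nat -> nat -> R) :=
  forall k e, 0 < e -> exists M, forall m, (M <= m)%N -> W k m <= e.

(** With y k = F k * H (n - k), the terms k >= K are handled by convolution
    boundedness, where the tail of F provides the smallness; the terms k < K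
    have a weight at most eta as soon as n >= K + M.  Both contributions have
    the form (sum of a_k H (n - k) ^ p) with the total mass of a at most 1/2. *)
Lemma bounded_sums_lp p (W : nat -> nat -> R) (F H : nat -> R) : 0 < p ->
  (forall k m, 0 <= W k m) -> (forall k, 0 <= F k) -> (forall k, 0 <= H k) ->
  conv_bounded p W -> vanishing_rows W ->
  bounded_sums (fun k => F k `^ p) ->
  (forall n, (0 < n)%N ->
     H n <= \sum_(k < n.+1) W k (n - k)%N * (F k * H (n - k)%N)) ->
  bounded_sums (fun k => H k `^ p).
Proof.
move=> p0 W0 F0 H0 [C C0 hC] hW hF hH.
have [S hS] := hF.
have S0 : 0 <= S by have := hS 0%N; rewrite big_ord0.
have t0 : 0 < (2 : R) `^ p by apply: powR_gt0; lra.
set t := 2 `^ p in t0.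
(* The two smallness parameters are tuned so that the part k >= K and the part
   k < K of the kernel a have mass at most 1/4 each. *)
have e1 : 0 < (4 * t * (C + 1))^-1 by rewrite invr_gt0 !mulr_gt0//; lra.
have [K hK] := bounded_sums_tail (fun k => powR_ge0 (F k) p) hF e1.
pose th : R := (4 * t * t ^+ K * (S + 1))^-1.
have th0 : 0 < th by rewrite invr_gt0 !mulr_gt0 ?exprn_gt0//; lra.
pose eta := th `^ p^-1.
have eta0 : 0 < eta by rewrite powR_gt0.
have etaE : eta `^ p = th by rewrite -powRrM mulVf ?gt_eqF// powRr1// ltW.
(* Finitely many rows vanish at infinity uniformly. *)
have [M hM] : exists M, forall k m, (k < K)%N -> (M <= m)%N -> W k m <= eta.
  elim: (K) => [|L [M hM]]; first by exists 0%N.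
  have [M' hM'] := hW L eta eta0; exists (maxn M M') => k m.
  rewrite ltnS leq_eqVlt geq_max => /predU1P[->|kL] /andP[Mm M'm].
    exact: hM'.
  exact: hM.
pose a k := if (K <= k)%N then t * C * F k `^ p else t * (t ^+ K * th) * F k `^ p.
have tth : 0 <= t * (t ^+ K * th).
  by rewrite !mulr_ge0 ?exprn_ge0 ?(ltW t0) ?(ltW th0).
have tC : 0 <= t * C by rewrite mulr_ge0// ltW.
have a0 k : 0 <= a k by rewrite /a; case: ifP => _; rewrite mulr_ge0 ?powR_ge0.
apply: (@renewal_bounded a _ (K + M).+1 a0) => [k|n|n hn]; first exact: powR_ge0.
  apply: (@le_trans _ _ (t * C * (\sum_(k < n) (if (K <= k)%N then F k `^ p else 0))
    + t * (t ^+ K * th) * \sum_(k < n) F k `^ p)).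
    rewrite !mulr_sumr -big_split/= ler_sum// => k _; rewrite /a.
    case: ifP => _; rewrite ?mulr0 ?add0r// lerDl mulr_ge0 ?powR_ge0//.
  apply: (@le_trans _ _ (t * C * (4 * t * (C + 1))^-1 + t * (t ^+ K * th) * S)).
    by rewrite lerD// ler_wpM2l.
  have -> : t * C * (4 * t * (C + 1))^-1 = 4^-1 * (C / (C + 1)).
    by field; apply/andP; split; rewrite ?gt_eqF//; lra.
  have -> : t * (t ^+ K * th) * S = 4^-1 * (S / (S + 1)).
    rewrite /th; field; rewrite !gt_eqF ?exprn_gt0//; lra.
  have C1 : C / (C + 1) <= 1 by rewrite ler_pdivrMr; lra.
  have S1 : S / (S + 1) <= 1 by rewrite ler_pdivrMr; lra.
  lra.
pose y k := F k * H (n - k)%N.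
have y0 k : 0 <= y k by exact: mulr_ge0.
have yE k : y k `^ p = F k `^ p * H (n - k)%N `^ p by rewrite powRM.
pose yt k := if (K <= k)%N then y k else 0.
pose yh k := if (K <= k)%N then 0 else y k.
have yt0 k : 0 <= yt k by rewrite /yt; case: ifP.
have yh0 k : 0 <= yh k by rewrite /yh; case: ifP.
have ytp k : yt k `^ p = if (K <= k)%N then y k `^ p else 0.
  by rewrite /yt; case: ifP => // _; rewrite powR0// gt_eqF.
have yhp k : yh k `^ p = if (K <= k)%N then 0 else y k `^ p.
  by rewrite /yh; case: ifP => // _; rewrite powR0// gt_eqF.
have Kn : (K <= n.+1)%N by rewrite (leq_trans (leq_addr M K))// leqW// ltnW.
have hhead : \sum_(k < n.+1) W k (n - k)%N * yh k <= eta * \sum_(k < K) y k.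
  have -> : \sum_(k < K) y k = \sum_(k < n.+1) yh k.
    rewrite (big_ord_widen_cond _ predT y Kn)/= [LHS]big_mkcond/=.
    by apply: eq_bigr => k _; rewrite /yh; case: leqP.
  rewrite mulr_sumr ler_sum// => k _; rewrite /yh; case: leqP => kK.
    by rewrite !mulr0.
  rewrite ler_wpM2r// hM//; move: hn kK; clear; lia.
have {}hhead : (\sum_(k < n.+1) W k (n - k)%N * yh k) `^ p <=
    t ^+ K * th * \sum_(k < n.+1) yh k `^ p.
  have -> : \sum_(k < n.+1) yh k `^ p = \sum_(k < K) y k `^ p.
    rewrite (big_ord_widen_cond _ predT (fun k => y k `^ p) Kn)/= [RHS]big_mkcond/=.
    by apply: eq_bigr => k _; rewrite yhp; case: leqP.
  have sy0 : 0 <= \sum_(k < K) y k by apply: sumr_ge0.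
  apply: (@le_trans _ _ ((eta * \sum_(k < K) y k) `^ p)).
    rewrite ge0_ler_powR ?(ltW p0) ?nnegrE ?mulr_ge0 ?(ltW eta0)//.
    by apply: sumr_ge0 => k _; exact: mulr_ge0.
  rewrite powRM ?(ltW eta0)// etaE [t ^+ K * _]mulrC -mulrA.
  by rewrite ler_wpM2l ?(ltW th0)// powR_sum_le.
apply: (@le_trans _ _ ((\sum_(k < n.+1) W k (n - k)%N * yt k +
    \sum_(k < n.+1) W k (n - k)%N * yh k) `^ p)).
  rewrite ge0_ler_powR ?(ltW p0) ?nnegrE ?addr_ge0 ?sumr_ge0//.
  - by move=> k _; rewrite mulr_ge0.
  - by move=> k _; rewrite mulr_ge0.
  apply: (le_trans (hH n (leq_ltn_trans (leq0n _) hn))).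
  rewrite -big_split/= ler_sum// => k _; rewrite -mulrDr ler_wpM2l//.
  by rewrite /yt /yh /y; case: ifP; rewrite ?addr0 ?add0r.
have sWt : 0 <= \sum_(k < n.+1) W k (n - k)%N * yt k.
  by apply: sumr_ge0 => k _; exact: mulr_ge0.
have sWh : 0 <= \sum_(k < n.+1) W k (n - k)%N * yh k.
  by apply: sumr_ge0 => k _; exact: mulr_ge0.
rewrite (le_trans (powRD_le (ltW p0) sWt sWh))// -/t.
apply: (@le_trans _ _ (t * (C * \sum_(k < n.+1) yt k `^ p +
    t ^+ K * th * \sum_(k < n.+1) yh k `^ p))).
  by rewrite ler_wpM2l ?(ltW t0)// lerD// hC.
rewrite !mulr_sumr -big_split/= mulr_sumr ler_sum// => k _.
rewrite ytp yhp yE /a; case: ifP => _; rewrite ?mulr0 ?addr0 ?add0r.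
  by rewrite !mulrA.
by rewrite !mulrA.
Qed.

End SumInequalities.

(** * The weights under the standing assumption *)

Section Weights.
Variables (R : realType) (beta delta : nat -> R).
Hypotheses (beta_gt0 : forall n, 0 < beta n) (delta_gt0 : forall n, 0 < delta n).

Lemma wratio_gt0 k m : 0 < wratio beta delta k m.
Proof. by rewrite /wratio !(mulr_gt0, invr_gt0). Qed.

Lemma wratioC k m : wratio beta delta k m = wratio beta delta m k.
Proof. by rewrite /wratio addnC; congr (_ / _); ring. Qed.

(** The weight restricted to the pairs of degrees that occur in the recursion for
    the inverse of 1 + f when f vanishes in degrees <= N: then f contributes only
    degrees > N, and the inverse only the degree 0 and degrees > N. *)
Definition gap_wratio N k m : R :=
  if (N < k)%N && ((m == 0%N) || (N < m)%N) then wratio beta delta k m else 0.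

Lemma gap_wratio_ge0 N k m : 0 <= gap_wratio N k m.
Proof. by rewrite /gap_wratio; case: ifP => // _; rewrite ltW// wratio_gt0. Qed.

Lemma gap_wratio_le N k m : gap_wratio N k m <= wratio beta delta k m.
Proof. by rewrite /gap_wratio; case: ifP => // _; rewrite ltW// wratio_gt0. Qed.

(** Here N = 0: the first part of the assumption is what Hoelder's inequality
    needs, and the second part is the decay of the rows. *)
Lemma standing_gap_gt1 p : 1 < p -> standing_assumption beta delta p ->
  conv_bounded p (gap_wratio 0) /\ vanishing_rows (gap_wratio 0).
Proof.
move=> p1 [/(_ p1)[]]; set q := fine _ => hsup hlim _.
have p0 : 0 < p by rewrite (lt_trans _ p1).
have qE : q = p / (p - 1).
  rewrite /q /hoelder_conjugate/= eqe (gt_eqF p0) -EFinD inver subr_eq0.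
  by rewrite (gt_eqF p1).
have q0 : 0 < q by rewrite qE divr_gt0// subr_gt0.
have pq : p^-1 + q^-1 = 1.
  by rewrite qE; field; rewrite subr_eq0 !gt_eqF.
split.
- cbv zeta in hsup; set s := ereal_sup _ in hsup.
  pose t n : R := \sum_(k < n.+1) (wratio beta delta k (n - k)%N) `^ q.
  have ts n : ((t n)%:E <= s)%E.
    apply: ereal_sup_ubound; exists n => //; congr (_%:E).
    apply: eq_bigr => k _; rewrite /wratio subnKC//.
    by rewrite -ltnS.
  have [B sE] : exists B, s = B%:E.
    by move: hsup (ts 0%N); case: (s) => // r _ _; exists r.
  exists (B `^ (q^-1 * p)); first exact: powR_ge0.
  move=> n y y0.
  pose w k := gap_wratio 0 k (n - k)%N.
  have w0 k : 0 <= w k by exact: gap_wratio_ge0.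
  have swB : \sum_(k < n.+1) w k `^ q <= B.
    rewrite -lee_fin -sE (le_trans _ (ts n))// lee_fin ler_sum// => k _.
    by rewrite ge0_ler_powR ?(ltW q0) ?nnegrE ?gap_wratio_le ?(ltW (wratio_gt0 _ _)).
  have sw0 : 0 <= \sum_(k < n.+1) w k `^ q.
    by apply: sumr_ge0 => k _; exact: powR_ge0.
  have sy0 : 0 <= \sum_(k < n.+1) y k `^ p.
    by apply: sumr_ge0 => k _; exact: powR_ge0.
  apply: (@le_trans _ _ (((\sum_(k < n.+1) w k `^ q) `^ q^-1 *
      (\sum_(k < n.+1) y k `^ p) `^ p^-1) `^ p)).
    rewrite ge0_ler_powR ?(ltW p0) ?nnegrE ?mulr_ge0 ?powR_ge0//.
      by apply: sumr_ge0 => k _; apply: mulr_ge0 => //; exact: w0.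
    exact: (@hoelder_sum _ p q w).
  move: sw0 swB sy0; move: (\sum_(k < n.+1) w k `^ q) => A.
  move: (\sum_(k < n.+1) y k `^ p) => Y sw0 swB sy0.
  rewrite powRM ?powR_ge0// -!powRrM mulVf ?gt_eqF// powRr1// ler_wpM2r//.
  have qp0 : 0 <= q^-1 * p by rewrite mulr_ge0 ?invr_ge0 ?(ltW q0) ?(ltW p0).
  by rewrite ge0_ler_powR ?nnegrE ?(le_trans sw0 swB).
- move=> k e e0; have [->|k0] := posnP k.
    by exists 0%N => m _; rewrite /gap_wratio/= ltW.
  have [M _ hM] : \forall M \near \oo, (bsup beta delta M k < e%:E)%E.
    have := hlim k k0 [set x : \bar R | (x < e%:E)%E]; apply.
    apply: open_nbhs_nbhs; split; last by rewrite /= lte_fin.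
    exact: open_ereal_lt_ereal.
  exists M.+1 => m Mm; apply: (le_trans (gap_wratio_le _ _ _)).
  rewrite -lee_fin (le_trans _ (ltW (hM M _)))//= wratioC.
  by apply: ereal_sup_ubound; exists m.
Qed.

(** A summable double sequence is bounded and each of its rows tends to 0; the
    only other entries are those in the column m = 0, where the weight is 1. *)
Lemma standing_gap_eq1 : beta 0%N = 1 -> delta 0%N = 1 ->
  standing_assumption beta delta 1 -> exists N,
  conv_bounded 1 (gap_wratio N) /\ vanishing_rows (gap_wratio N).
Proof.
move=> beta0 delta0 [_ /(_ erefl)[N _]]; set s := esum _ _ => hs; exists N.
have s0 : (0 <= s)%E.
  by apply: esum_ge0 => i _; rewrite lee_fin ltW// wratio_gt0.
have [S sE] : exists S, s = S%:E.
  by move: hs s0; case: (s) => // r _ _; exists r.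
have S0 : 0 <= S by rewrite -lee_fin -sE.
pose u k m := if (N < m)%N then wratio beta delta k m else 0.
have u0 k m : 0 <= u k m.
  by rewrite /u; case: ifP => // _; rewrite ltW// wratio_gt0.
have hu k : (N < k)%N -> forall n, \sum_(m < n) u k m <= S.
  move=> Nk n; rewrite -lee_fin -sE.
  pose r := [seq (k, m) | m <- index_iota 0 n & (N < m)%N].
  apply: esum_ge; exists [set` r].
    split; first exact: finite_seq.
    by move=> [i j] /= /mapP[m]; rewrite mem_filter => /andP[Nm _] [-> ->].
  rewrite -fsbig_seq; last first.
    by rewrite map_inj_uniq ?filter_uniq ?iota_uniq// => ? ? [].
  rewrite big_map big_filter [leRHS]big_mkcond big_mkord -sumEFin/= le_eqVlt.
  apply/orP; left; apply/eqP; apply: eq_bigr => m _.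
  by rewrite /u; case: ifP.
have hw k : wratio beta delta k 0 = 1.
  rewrite /wratio addn0 beta0 delta0; field.
  by rewrite !gt_eqF.
split.
- exists (1 + S); first by rewrite addr_ge0.
  move=> n y y0.
  have sy0 : 0 <= \sum_(k < n.+1) gap_wratio N k (n - k)%N * y k.
    by apply: sumr_ge0 => k _; rewrite mulr_ge0// gap_wratio_ge0.
  rewrite powRr1// mulr_sumr ler_sum// => k _; rewrite powRr1// ler_wpM2r//.
  rewrite /gap_wratio; case: ifPn => [/andP[Nk /orP[/eqP ->|Nm]]|_].
  + by rewrite hw lerDl.
  + apply: (@le_trans _ _ S); last by rewrite lerDr.
    apply: le_trans (hu k Nk (n - k).+1); rewrite big_ord_recr/=.
    by rewrite {2}/u Nm lerDr sumr_ge0.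
  + by rewrite addr_ge0.
- move=> k e e0; have [Nk|kN] := ltnP N k; last first.
    by exists 0%N => m _; rewrite /gap_wratio ltnNge kN/= ltW.
  have [M hM] := bounded_sums_cvg0 (u0 k) (ex_intro _ S (hu k Nk)) e0.
  exists M.+1 => m Mm; have := hM m (ltnW Mm); rewrite /u /gap_wratio Nk/=.
  by case: m Mm => //= m _.
Qed.

Lemma standing_gap p : 1 <= p -> beta 0%N = 1 -> delta 0%N = 1 ->
  standing_assumption beta delta p -> exists N,
  conv_bounded p (gap_wratio N) /\ vanishing_rows (gap_wratio N).
Proof.
rewrite le_eqVlt => /predU1P[<-|p1] beta0 delta0; first exact: standing_gap_eq1.
by move=> /(standing_gap_gt1 p1); exists 0%N.
Qed.

End Weights.

(** * Formal series *)

(** Iterating the functional n.+1 times from an arbitrary start stabilises the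
    value at n, since this value only depends on those at smaller arguments. *)
Lemma strong_recursion (T : Type) (x0 : T) (step : nat -> (nat -> T) -> T) :
  (forall n g g', (forall m, (m < n)%N -> g m = g' m) ->
     step n g = step n g') ->
  exists h, forall n, h n = step n h.
Proof.
move=> hstep; pose G n := iter n (fun g m => step m g) (fun=> x0).
have GE m : forall i j, (m < i)%N -> (m < j)%N -> G i m = G j m.
  elim/ltn_ind: m => m IH [//|i] [//|j] mi mj; apply: hstep => l lm.
  by apply: IH => //; [exact: leq_trans lm mi|exact: leq_trans lm mj].
exists (fun n => G n.+1 n) => n; apply: hstep => m mn.
exact: GE.
Qed.

Section NormC.
Variable R : realType.

Lemma normc_ge0 (x : R[i]) : 0 <= normc x.
Proof. by case: x => a b; exact: sqrtr_ge0. Qed.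

Lemma normc_real (x : R) : 0 <= x -> normc x%:C%C = x.
Proof. by move=> x0; rewrite /normc/= expr0n addr0 sqrtr_sqr ger0_norm. Qed.

Lemma normc_sum n (u : nat -> R[i]) :
  normc (\sum_(k < n) u k) <= \sum_(k < n) normc (u k).
Proof.
elim: n => [|n IH]; first by rewrite !big_ord0 normc0.
by rewrite !big_ord_recr/= (le_trans (le_normcD _ _))// lerD2r.
Qed.

End NormC.

(** * Inverses in l^p(beta) *)

Section Algebra.
Variables (R : realType) (beta delta : nat -> R) (p : R) (hp : 1 <= p).
Hypotheses (beta_gt0 : forall n, 0 < beta n) (delta_gt0 : forall n, 0 < delta n).

Let p_gt0 : 0 < p. Proof. exact: lt_le_trans hp. Qed.

(** Working with real partial sums keeps extended reals out of all estimates. *)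
Lemma lpb_predP (f : fpseries R) : f \in lpb_pred beta hp <->
  bounded_sums (fun n => (normc (f n) * beta n) `^ p).
Proof.
have E n : (normc (f n) `^ p * beta n `^ p)%:E =
    ((normc (f n) * beta n) `^ p)%:E.
  by rewrite powRM ?normc_ge0// ltW.
have t0 n : (0 <= (normc (f n) `^ p * beta n `^ p)%:E)%E.
  by rewrite E lee_fin powR_ge0.
have sE n : (\sum_(0 <= k < n) (normc (f k) `^ p * beta k `^ p)%:E)%E =
    (\sum_(k < n) (normc (f k) * beta k) `^ p)%:E.
  by rewrite big_mkord -sumEFin; apply: eq_bigr => k _.
split.
- move/asboolP; rewrite /lpb_npow; set s := limn _ => hs.
  have hle n : ((\sum_(k < n) (normc (f k) * beta k) `^ p)%:E <= s)%E.
    by rewrite -sE; apply: nneseries_lim_ge.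
  have : (0 <= s)%E by rewrite (le_trans _ (hle 0%N))// big_ord0.
  move: hs hle; case: s => // r _ hle _; exists r => n.
  by rewrite -lee_fin.
- move=> [S hS]; apply/asboolP; apply: (@le_lt_trans _ _ S%:E); last exact: ltry.
  apply: lime_le; first by apply: is_cvg_nneseries => n _ _; exact: t0.
  by apply: nearW => n /=; rewrite sE lee_fin.
Qed.

Definition monomial j : fpseries R := fun n => (n == j)%:R.

Lemma monomial_lpb j : monomial j \in lpb_pred beta hp.
Proof.
apply/lpb_predP; exists (beta j `^ p) => n.
have E k : (normc (monomial j k) * beta k) `^ p =
    if k == j then beta j `^ p else 0.
  rewrite /monomial; case: eqVneq => [->|_]; first by rewrite normc1 mul1r.
  by rewrite normc0 mul0r powR0// gt_eqF.
under eq_bigr do rewrite E.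
rewrite -big_mkcond/=; have [jn|nj] := ltnP j n.
  by rewrite (big_pred1 (Ordinal jn))// => k.
rewrite big_pred0 ?powR_ge0// => k; apply/negbTE; apply: contraL nj.
by move=> /eqP <-; rewrite -ltnNge.
Qed.

Definition lpb_monomial j : lpb beta hp := Lpb (monomial_lpb j).

Definition wcoef n k : R[i] := (delta n / (delta k * delta (n - k)%N))%:C%C.

Lemma wcauchy_inverse (g : fpseries R) : delta 0%N = 1 -> g 0%N = 1 ->
  exists2 h : fpseries R, wcauchy delta g h = monomial 0 & h 0%N = 1 /\
    forall n, (0 < n)%N ->
    h n = - \sum_(k < n) wcoef n k.+1 * g k.+1 * h (n - k.+1)%N.
Proof.
move=> delta0 g0.
pose step n (h : fpseries R) : R[i]^o := if n == 0%N then 1 else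
  - \sum_(k < n) wcoef n k.+1 * g k.+1 * h (n - k.+1)%N.
have [|h hE] := @strong_recursion R[i]^o 0 step.
  move=> n h h' hh; rewrite /step; case: eqP => // /eqP; rewrite -lt0n => n0.
  by congr (- _); apply: eq_bigr => k _; rewrite hh// ltn_subrL n0.
have h0 : h 0%N = 1 by rewrite hE.
have hS n : (0 < n)%N ->
    h n = - \sum_(k < n) wcoef n k.+1 * g k.+1 * h (n - k.+1)%N.
  by move=> n0; rewrite hE /step gtn_eqF.
exists h => //; apply/funext => n; rewrite /wcauchy big_ord_recl/= subn0.
rewrite delta0 mul1r divff ?gt_eqF// g0 !mul1r /monomial.
case: n => [|n]; first by rewrite big_ord0 addr0 h0.
by rewrite [in LHS]hS// addNr.
Qed.

(** The formal inverse of g has the same gap 1 .. N as g, so its recursion only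
    involves pairs of degrees in the support of [gap_wratio], and
    [bounded_sums_lp] applies with F and H the weighted moduli of g and h. *)
Lemma lpb_inverse N (g : lpb beta hp) : delta 0%N = 1 ->
  conv_bounded p (gap_wratio beta delta N) ->
  vanishing_rows (gap_wratio beta delta N) ->
  g 0%N = 1 -> (forall k, (0 < k <= N)%N -> g k = 0) ->
  exists h : lpb beta hp, wcauchy delta g h = monomial 0.
Proof.
move=> delta0 hW1 hW2 g0 gN.
have [h ghE [h0 hS]] := wcauchy_inverse delta0 g0.
have hN m : (0 < m <= N)%N -> h m = 0.
  move=> /andP[m0 mN]; rewrite hS// big1 ?oppr0// => k _.
  by rewrite gN ?mulr0 ?mul0r//= (leq_trans (ltn_ord k)).
suff hlp : h \in lpb_pred beta hp by exists (Lpb hlp).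
apply/lpb_predP.
apply: (@bounded_sums_lp _ _ (gap_wratio beta delta N)
  (fun n => normc (g n) * beta n) (fun n => normc (h n) * beta n)) => //.
- by move=> k m; exact: gap_wratio_ge0.
- by move=> k; rewrite mulr_ge0 ?normc_ge0// ltW.
- by move=> k; rewrite mulr_ge0 ?normc_ge0// ltW.
- by apply/lpb_predP; exact: lpb_coefP.
move=> n n0; rewrite big_ord_recl/= {1}/gap_wratio/= mul0r add0r hS// normcN.
apply: (@le_trans _ _ ((\sum_(k < n)
    normc (wcoef n k.+1 * g k.+1 * h (n - k.+1)%N)) * beta n)).
  rewrite ler_wpM2r ?(ltW (beta_gt0 n))//.
  exact: (normc_sum n (fun k => wcoef n k.+1 * g k.+1 * h (n - k.+1)%N)).
rewrite mulr_suml ler_sum// => k _; rewrite /bump/= add1n.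
have kn : (k.+1 <= n)%N by exact: ltn_ord.
rewrite /gap_wratio; case: ifPn => [_|].
  have c0 : 0 <= delta n / (delta k.+1 * delta (n - k.+1)%N).
    by rewrite divr_ge0 ?mulr_ge0 ?(ltW (delta_gt0 _)).
  rewrite !normcM normc_real// /wratio subnKC// le_eqVlt; apply/orP; left.
  by apply/eqP; field; rewrite !gt_eqF.
rewrite mul0r negb_and -leqNgt negb_or -lt0n -leqNgt.
case/orP => [kN|/hN ->]; last by rewrite mulr0 normc0 mul0r.
by rewrite gN ?mulr0 ?mul0r ?normc0 ?mul0r.
Qed.

Lemma wcauchy1l (f : fpseries R) : delta 0%N = 1 ->
  wcauchy delta (monomial 0) f = f.
Proof.
move=> delta0; apply/funext => n; rewrite /wcauchy big_ord_recl/= subn0.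
rewrite delta0 mul1r divff ?gt_eqF// /monomial/= !mul1r big1 ?addr0// => k _.
by rewrite mulr0 mul0r.
Qed.

Lemma wcauchy_monomial i j n : wcauchy delta (monomial i) (monomial j) n =
  wcoef (i + j) i * monomial (i + j) n.
Proof.
rewrite /wcauchy.
transitivity (\sum_(k < n.+1) if k == i :> nat then
   wcoef n i * (n - i == j)%N%:R else 0 : R[i]).
  apply: eq_bigr => k _; rewrite /monomial.
  by case: eqVneq => [->|_]; rewrite ?mulr1// mulr0 mul0r.
rewrite -big_mkcond/= /monomial; have [i_n|ni] := ltnP i n.+1.
  rewrite (big_pred1 (Ordinal i_n))//.
  have -> : (n - i == j)%N = (n == i + j)%N.
    by rewrite -(eqn_add2l i) subnKC.
  by case: eqVneq => [->//|_]; rewrite !mulr0.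
rewrite big_pred0; last first.
  by move=> k; apply/negbTE; rewrite neq_ltn (leq_trans (ltn_ord k)).
by rewrite ltn_eqF ?mulr0// (leq_trans ni)// leq_addr.
Qed.

(** * Characters *)

Section Character.
Variable (phi : lpb beta hp -> R[i]).
Hypothesis phi_in : maximal_ideal_space beta delta hp phi.
Hypothesis (delta0 : delta 0%N = 1).

Let phiP a u v : phi (a *: u + v) = a * phi u + phi v.
Proof. by case: phi_in => h _ _; exact: h. Qed.

Let phiM (f g h : lpb beta hp) :
  lpb_coef h = wcauchy delta f g -> phi h = phi f * phi g.
Proof. by case: phi_in => _ _; exact. Qed.

Lemma character1 : phi (lpb_monomial 0) = 1.
Proof.
case: phi_in => _ [f /eqP pf] _; apply: (mulIf pf).
by rewrite mul1r -(@phiM _ _ f)//= wcauchy1l.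
Qed.

(** If phi f <> 0, the series 1 - f / phi f is invertible and lies in the kernel
    of phi. *)
Lemma character_vanish N : conv_bounded p (gap_wratio beta delta N) ->
  vanishing_rows (gap_wratio beta delta N) ->
  forall f : lpb beta hp, (forall k, (k <= N)%N -> f k = 0) -> phi f = 0.
Proof.
move=> hW1 hW2 f fN; apply/eqP; apply: contraT => pf0.
pose g := (- (phi f)^-1) *: f + lpb_monomial 0.
have gE k : g k = - (phi f)^-1 * f k + (k == 0%N)%:R by [].
have [||h ghE] := lpb_inverse (g := g) delta0 hW1 hW2.
- by rewrite gE fN// mulr0 add0r.
- by move=> [//|k] /andP[_ kN]; rewrite gE fN// mulr0 add0r.
have := phiM (h := lpb_monomial 0) (esym ghE).
rewrite character1 /g phiP character1 mulNr mulVf// addNr mul0r => /eqP.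
by rewrite oner_eq0.
Qed.

(** Descending induction from the degree N.+1 supplied by [character_vanish]:
    once phi kills the series starting in degree j.+1, it kills the square of
    z^j, hence z^j, hence the series starting in degree j. *)
Lemma character_coef0 N : conv_bounded p (gap_wratio beta delta N) ->
  vanishing_rows (gap_wratio beta delta N) ->
  forall f : lpb beta hp, phi f = f 0%N.
Proof.
move=> hW1 hW2.
have down d j : (0 < j)%N -> (d + j = N.+1)%N ->
    forall f : lpb beta hp, (forall k, (k < j)%N -> f k = 0) -> phi f = 0.
  elim: d j => [|d IH] j j0 djN f fj.
    by apply: (character_vanish hW1 hW2) => k kN; rewrite fj// -[j]add0n djN.
  have {}IH := IH j.+1 erefl; rewrite addnS -addSn in IH.
  have zj : phi (lpb_monomial j) = 0.
    have /phiM : lpb_coef (wcoef (j + j) j *: lpb_monomial (j + j) + 0) =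
        wcauchy delta (lpb_monomial j) (lpb_monomial j).
      by apply/funext => n; rewrite wcauchy_monomial addr0.
    rewrite IH//; first by move=> /esym/eqP; rewrite mulf_eq0 orbb => /eqP.
    move=> k kj; rewrite addr0.
    have -> : (wcoef (j + j) j *: lpb_monomial (j + j)) k =
      wcoef (j + j) j * (k == j + j)%N%:R by [].
    by rewrite ltn_eqF ?mulr0// (leq_trans kj)// -addn1 leq_add2l.
  have := phiP (- f j) (lpb_monomial j) f.
  rewrite zj mulr0 add0r => <-; apply: IH => // k.
  have -> : (- f j *: lpb_monomial j + f) k = - f j * (k == j)%:R + f k by [].
  rewrite ltnS leq_eqVlt => /predU1P[->|kj]; first by rewrite eqxx mulr1 addNr.
  by rewrite ltn_eqF// mulr0 add0r fj.
move=> f; have := phiP (- f 0%N) (lpb_monomial 0) f.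
rewrite character1 mulr1 (down N 1%N)//; last first.
- move=> [|//] _.
  have -> : (- f 0%N *: lpb_monomial 0 + f) 0%N = - f 0%N * 1 + f 0%N by [].
  by rewrite mulr1 addNr.
- by rewrite addn1.
by move/esym/eqP; rewrite addrC subr_eq0 => /eqP.
Qed.

End Character.

Lemma coef0_character : delta 0%N = 1 ->
  maximal_ideal_space beta delta hp (fun f : lpb beta hp => f 0%N).
Proof.
move=> delta0; split=> [a u v //||f g h ->].
- by exists (lpb_monomial 0); apply/eqP; rewrite oner_neq0.
- by rewrite /wcauchy big_ord1 subnn delta0 !mul1r invr1 mul1r.
Qed.

End Algebra.

Theorem corollary2p5 (R : realType) (beta delta : nat -> R)
    (beta_gt0 : forall n, 0 < beta n) (delta_gt0 : forall n, 0 < delta n)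
    (beta0 : beta 0%N = 1) (delta0 : delta 0%N = 1)
    (p : R) (hp : 1 <= p)
    (hstanding : standing_assumption beta delta p) :
  maximal_ideal_space beta delta hp =
    [set (fun f : lpb beta hp => lpb_coef f 0%N)].
Proof.
have [N [hW1 hW2]] := standing_gap beta_gt0 delta_gt0 hp beta0 delta0 hstanding.
apply/seteqP; split=> [phi hphi|_ ->]; last exact: coef0_character.
by apply/funext => f; exact: (character_coef0 _ _ hphi _ hW1 hW2).
Qed.
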